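(* Let $u$ be a nonprincipal ultrafilter on $\mathbb{Z}$ that is $\mathbb{Z}$-Ramsey and is also a P-point. Then $u$ is a selective ultrafilter.
   Context: A colouring $c:[\mathbb{Z}]^2\to 2$ (where $[\mathbb{Z}]^2$ is the set of 2-element subsets of $\mathbb{Z}$ and $2=\{0,1\}$) is $\mathbb{Z}$-invariant if $c(\{x,y\})=c(\{x+z,y+z\})$ for all distinct $x,y\in\mathbb{Z}$ and all $z\in\mathbb{Z}$. An ultrafilter $u$ on $\mathbb{Z}$ is $\mathbb{Z}$-Ramsey if for every $\mathbb{Z}$-invariant colouring $c:[\mathbb{Z}]^2\to 2$ there is $A\in u$ such that $c$ is constant on $[A]^2$. A nonprincipal ultrafilter $u$ on a countable set $S$ is a P-point if every function $f:S\to\omega$ is constant or finite-to-one on some element of $u$. A nonprincipal ultrafilter $u$ on a countable set $S$ is selective (equivalently, Ramsey) if for every partition of $S$, either some piece of the partition belongs to $u$ or there is $A\in u$ meeting each piece in at most one point. *)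

(* Defs.v *)
From mathcomp Require Import all_boot all_order all_algebra finmap.
From mathcomp Require Import mathcomp_extra boolp classical_sets functions.
From mathcomp Require Import cardinality filter.

Set Implicit Arguments.
Unset Strict Implicit.
Unset Printing Implicit Defensive.

Import GRing.Theory.

Local Open Scope classical_set_scope.
Local Open Scope ring_scope.

(** The set [T]^2 of two-element subsets of T. *)
Definition doubleton (T : choiceType) : Type := {p : {fset T} | #|` p| == 2%N}.

Lemma card_doubleton (T : choiceType) (x y : T) :
  x != y -> #|` [fset x; y]%fset| == 2%N.
Proof. by move=> xy; rewrite cardfs2 xy. Qed.

Definition mk_doubleton (T : choiceType) (x y : T) (xy : x != y) :
  doubleton T := exist _ [fset x; y]%fset (card_doubleton xy).

Definition colouring (T : choiceType) : Type := doubleton T -> bool.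

(** c is constant on [A]^2. *)
Definition monochromatic (T : choiceType) (c : colouring T) (A : set T) : Prop :=
  exists b : bool, forall p : doubleton T, [set` sval p] `<=` A -> c p = b.

(** [xyz] follows from [xy]; it is only there to form {x + z, y + z}. *)
Definition Z_invariant (c : colouring int) : Prop :=
  forall (x y z : int) (xy : x != y) (xyz : x + z != y + z),
    c (mk_doubleton xy) = c (mk_doubleton xyz).

Definition Z_Ramsey (u : set_system int) : Prop :=
  UltraFilter u /\
  forall c : colouring int, Z_invariant c ->
    exists A : set int, u A /\ monochromatic c A.

Definition nonprincipal (T : Type) (u : set_system T) : Prop :=
  forall x : T, u <> principal_filter x.

Definition P_point (S : countType) (u : set_system S) : Prop :=
  [/\ UltraFilter u, nonprincipal u &
      forall f : S -> nat, exists A : set S,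
        u A /\ ((exists n, forall x, A x -> f x = n) \/
                (forall n, finite_set (A `&` f @^-1` [set n])))].

(** A partition is given as the set P of its pieces, hence indexed by [id]. *)
Definition selective (S : countType) (u : set_system S) : Prop :=
  [/\ UltraFilter u, nonprincipal u &
      forall P : set (set S), partition P id [set: S] ->
        (exists B : set S, P B /\ u B) \/
        (exists A : set S, u A /\ forall B, P B -> is_subset1 (A `&` B))].

(* Main.v *)
(** Invariant colourings of pairs of integers are the colourings that depend only
on the distance.  If some element of [u] is lacunary ([2|x| < |y|] whenever
[|x| < |y|]) and its points have the same sign, then the distance of two of its
points determines the pair, so every colouring of its pairs is induced by an
invariant one and selectivity follows.

To get a lacunary element, choose [A n] in [u] whose distances are all divisible
by [2 ^ n].  As [u] is a P-point, some [A] in [u] and [G : nat -> nat] satisfy: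
if [x] is in [A] and [G n <= |x|] then [x] is in [A n].  Colour a distance [d]
according to whether [G n.+1 <= d] for all [n] with [2 ^ n %| d].  A homogeneous
set of the negative colour is bounded.  In a homogeneous subset of [A] of the
positive colour, let [|x| < |y|] and [d = |y| - |x|]; were [d <= |x|], then
[G n <= |x|] would give [2 ^ n %| d], hence [G n.+1 <= d <= |x|], so by induction
every [2 ^ n] would divide [d]. *)
Require Import Defs.
From mathcomp Require Import all_boot all_order all_algebra finmap.
From mathcomp Require Import mathcomp_extra boolp classical_sets functions.
From mathcomp Require Import cardinality filter.
From mathcomp Require Import zify ring.

Set Implicit Arguments.
Unset Strict Implicit.
Unset Printing Implicit Defensive.

Import GRing.Theory.

Local Open Scope classical_set_scope.

Local Notation dist x y := (absz (x - y)%R).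

Lemma nonprincipal_setC1 (T : Type) (u : set_system T) (x : T) :
  UltraFilter u -> nonprincipal u -> u (~` [set x]).
Proof.
move=> uU npu; case: (in_ultra_setVsetC [set x] uU) => // ux.
case: (npu x); apply/predeqP => A; rewrite principal_filterP; split.
  by move=> uA; have [y [/= -> ?]] := filter_ex (filterI ux uA).
by move=> Ax; apply: filterS ux => y ->.
Qed.

Lemma nonprincipal_unbounded (u : set_system int) (k : nat) :
  UltraFilter u -> nonprincipal u -> u [set x : int | k <= absz x].
Proof.
move=> uU npu; elim: k => [|k IH]; first by apply: filterS filterT => x.
have ux := @nonprincipal_setC1 _ _ _ uU npu.
apply: filterS (filterI IH (filterI (ux (Posz k)) (ux (- Posz k)%R))) => x /=.
by move=> [? [? ?]]; lia.
Qed.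

(** The P-point property is applied to the [f] sending [x] to [0] if [x] is in every [A n], and
    otherwise to [n.+1] for the least [n] with [x] outside [A n]. Points outside [A n] have value at
    most [n.+1]. *)
Lemma P_point_pseudo_intersection (S : countType) (u : set_system S)
    (A : nat -> set S) :
  P_point u -> (forall n, u (A n)) ->
  exists B, u B /\ forall n, finite_set (B `\` A n).
Proof.
move=> [uU _ uP] uA.
have outP x : exists k, if k is n.+1 then ~ A n x /\ forall m, m < n -> A m x
                        else forall n, A n x.
  have [all|/existsNP[n0 n0P]] := pselect (forall n, A n x); first by exists 0.
  have ex : exists n, `[< ~ A n x >] by exists n0; apply/asboolP.
  exists (ex_minn ex).+1; case: ex_minnP => n /asboolP nA nmin; split => // m mn.
  by apply: contrapT => nAm; have := nmin m (introT (asboolP _) nAm); lia.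
have [f fP] := choice outP.
have [B [uB [[k fk]|fin]]] := uP f.
  exists B; split => // n; have [x Bx] := filter_ex uB.
  case: k fk => [|k] fk.
    suff -> : B `\` A n = set0 by [].
    by rewrite -subset0 => y [By nAy]; have := fP y; rewrite (fk y By).
  (* A constant value [k.+1] would make [B] disjoint from [A k], yet both are in [u]. *)
  have [y [By Ay]] := filter_ex (filterI uB (uA k)).
  by have := fP y; rewrite (fk y By) => -[].
exists B; split => // n.
apply: (@sub_finite_set _ _ (\bigcup_(k in `I_n.+2) (B `&` f @^-1` [set k]))).
  move=> x [Bx nA]; exists (f x) => //=; have := fP x.
  case: (f x) => [/(_ n)//|k [_ kmin]].
  by rewrite !ltnS leqNgt; apply/negP => /kmin.
by apply: bigcup_finite => // k _; exact: fin.
Qed.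

Lemma finite_set_int_bounded (A : set int) :
  finite_set A -> exists k, forall x, A x -> absz x < k.
Proof.
move=> /finite_fsetP[X ->]; exists (\sum_(x <- X) absz x).+1 => x /= xX.
by rewrite ltnS (big_fsetD1 x xX) /= leq_addr.
Qed.

(** As [dist] is symmetric, the existential avoids choosing an order on the pair. *)
Definition distance_colouring (chi : nat -> bool) : colouring int :=
  fun p => `[< exists x y : int,
    [/\ x \in sval p, y \in sval p, x != y & chi (dist x y)] >].

Lemma distance_colouringE (chi : nat -> bool) (x y : int) (xy : x != y) :
  distance_colouring chi (mk_doubleton xy) = chi (dist x y).
Proof.
apply/asboolP/idP => [[a [b []]]|cxy].
  rewrite !in_fset2 => /orP[]/eqP-> /orP[]/eqP-> //; rewrite ?eqxx // => _.
  by rewrite distnC.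
by exists x, y; split; rewrite ?in_fset2 ?eqxx ?orbT.
Qed.

Lemma Z_Ramsey_distance (u : set_system int) (chi : nat -> bool) :
  Z_Ramsey u ->
  exists A b, u A /\ forall x y, A x -> A y -> x != y -> chi (dist x y) = b.
Proof.
move=> [_ /(_ (distance_colouring chi))[]].
  move=> x y z xy xyz; rewrite !distance_colouringE.
  by rewrite (_ : (x + z - (y + z) = x - y)%R) //; ring.
move=> A [uA [b cb]]; exists A, b; split => // x y Ax Ay xy.
rewrite -(distance_colouringE chi xy); apply: cb => z /=.
by rewrite in_fset2 => /orP[]/eqP->.
Qed.

(** Otherwise, discarding the classes one by one keeps [k <= x %% m] in [u] for every [k], absurd at
    [k = m]. *)
Lemma ultra_residue (u : set_system int) (m : nat) :
  UltraFilter u -> 0 < m -> exists r, u [set x | (x %% m)%Z = r].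
Proof.
move=> uU m0; apply: contrapT => /forallNP nr.
have umod k : u [set x : int | (Posz k <= (x %% m)%Z)%R].
  elim: k => [|k IH].
    by apply: filterS filterT => x _ /=; apply: modz_ge0; lia.
  have [/nr//|uC] := in_ultra_setVsetC [set x | (x %% m)%Z = k] uU.
  by apply: filterS (filterI IH uC) => x /= [? ?]; lia.
have [x /= mx] := filter_ex (umod m).
by have := @ltz_pmod x m; lia.
Qed.

Lemma ultra_dvd_dist (u : set_system int) (m : nat) :
  UltraFilter u -> 0 < m ->
  exists A, u A /\ forall x y, A x -> A y -> m %| dist x y.
Proof.
move=> uU m0; have [r ur] := ultra_residue uU m0.
exists [set x | (x %% m)%Z = r]; split => // x y /= xr yr.
have : (Posz m %| (x - y)%R)%Z by rewrite -eqz_mod_dvd xr yr.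
by rewrite dvdzE.
Qed.

Definition lacunary (A : set int) : Prop :=
  forall x y, A x -> A y -> absz x < absz y -> 2 * absz x < absz y.

(** Amounts to no two points having strictly opposite signs, in the form needed to compute
    distances. *)
Definition same_sign (A : set int) : Prop :=
  forall x y, A x -> A y -> dist x y = dist (Posz (absz x)) (Posz (absz y)).

Lemma ultra_same_sign (u : set_system int) :
  UltraFilter u -> exists A, u A /\ same_sign A.
Proof.
move=> uU; have [uP|uN] := in_ultra_setVsetC [set x : int | (0 <= x)%R] uU.
  by exists [set x : int | (0 <= x)%R]; split => // x y /=; lia.
by exists (~` [set x : int | (0 <= x)%R]); split => // x y /=; lia.
Qed.

Lemma same_sign_sub (A B : set int) : A `<=` B -> same_sign B -> same_sign A.
Proof. by move=> AB ssB x y /AB Bx /AB By; exact: ssB. Qed.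

Lemma same_sign_inj (A : set int) (x y : int) :
  same_sign A -> A x -> A y -> absz x = absz y -> x = y.
Proof. by move=> ssA Ax Ay xy; have := ssA _ _ Ax Ay; lia. Qed.

(* If [x] and [z] are at distance [N > 0], then [2 ^ N] cannot divide both of their
distances to a third point [y], so one of these is below some [G n.+1] with [n < N]. *)
Lemma dist_bounded_of_pow2_dvd (u : set_system int) (G : nat -> nat)
    (A : set int) :
  UltraFilter u -> nonprincipal u -> u A ->
  ~ (forall x y, A x -> A y -> x != y ->
       exists n, 2 ^ n %| dist x y /\ dist x y < G n.+1).
Proof.
move=> uU npu uA AP; have ub := @nonprincipal_unbounded u _ uU npu.
have [x Ax] := filter_ex uA.
have [z [Az /= xz]] := filter_ex (filterI uA (ub (absz x).+1)).
(* [M] bounds all [G n.+1] with [n < N]; [y] is taken so far out that its distances to [x] and [z]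
   exceed [M], which forces [N <= n]. *)
pose N := dist x z; pose M := \sum_(i < N) G i.+1.
have [y [Ay /= Hy]] := filter_ex (filterI uA (ub (absz x + absz z + M).+1)).
have close w : A w -> absz w <= absz x + absz z -> 2 ^ N %| dist w y.
  move=> Aw wle; have wy : w != y by apply/eqP => ?; subst w; lia.
  have [n [dvn ltn]] := AP _ _ Aw Ay wy.
  have [nN|Nn] := ltnP n N; last exact: dvdn_trans (dvdn_exp2l 2 Nn) dvn.
  have : G n.+1 <= M by rewrite /M (bigD1 (Ordinal nN)) //= leq_addr.
  by lia.
have dxz : (Posz (2 ^ N) %| (x - z)%R)%Z.
  rewrite (_ : (x - z = (x - y) - (z - y))%R); last by ring.
  by apply: rpredB; rewrite dvdzE; apply: close => //; lia.
move: dxz; rewrite dvdzE /= => /dvdn_leq.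
have := ltn_expl N (ltnSn 1); rewrite /N; lia.
Qed.

Lemma lacunary_of_dist_large (G : nat -> nat) (B : nat -> set int)
    (A : set int) :
  (forall n x y, B n x -> B n y -> 2 ^ n %| dist x y) ->
  (forall n x, A x -> G n <= absz x -> B n x) ->
  (forall x, A x -> G 0 <= absz x) ->
  same_sign A ->
  (forall x y n, A x -> A y -> x != y -> 2 ^ n %| dist x y ->
     G n.+1 <= dist x y) ->
  lacunary A.
Proof.
move=> Bdvd AB A0 ssA Alarge x y Ax Ay xy.
have dE := ssA _ _ Ax Ay.
have xNy : x != y by apply/eqP => ?; subst y; lia.
(* By [dE] the distance is [|y| - |x|], so [le2] makes it at most [|x|]. *)
rewrite ltnNge; apply/negP => le2.
have dvd n : G n <= absz x -> 2 ^ n %| dist x y.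
  by move=> Gx; apply: Bdvd; apply: AB => //; lia.
have Gx n : G n <= absz x.
  elim: n => [|n IH]; first exact: A0.
  by have := Alarge _ _ _ Ax Ay xNy (dvd _ IH); lia.
(* A positive [d] is not divisible by [2 ^ d], which exceeds it. *)
have /dvdn_leq := dvd _ (Gx (dist x y)).
by have := ltn_expl (dist x y) (ltnSn 1); lia.
Qed.

Lemma Z_Ramsey_P_point_lacunary (u : set_system int) :
  Z_Ramsey u -> P_point u -> exists A, [/\ u A, same_sign A & lacunary A].
Proof.
move=> uR uPp; have [uU npu _] := uPp.
have [B BP] := choice (fun n => ultra_dvd_dist uU (expn_gt0 2 n)).
have [A0 [uA0 A0fin]] := P_point_pseudo_intersection uPp (fun n => (BP n).1).
have [G GP] := choice (fun n => finite_set_int_bounded (A0fin n)).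
have A0B n x : A0 x -> G n <= absz x -> B n x.
  by move=> Ax Gx; apply: contrapT => nB; have := GP n x (conj Ax nB); lia.
pose chi d := `[< forall n, 2 ^ n %| d -> G n.+1 <= d >].
have [C [b [uC Cb]]] := Z_Ramsey_distance chi uR.
case: b Cb => Cb; last first.
  case: (@dist_bounded_of_pow2_dvd u G C uU npu uC) => x y Cx Cy xy.
  have /asboolP/existsNP[n /not_implyP[dvn /negP]] := negbT (Cb _ _ Cx Cy xy).
  by rewrite -ltnNge => ltn; exists n.
have [S [uS ssS]] := ultra_same_sign uU.
(* The bound [G 0 <= |x|] starts the induction giving all [G n <= |x|]. *)
pose A := [set x | [/\ A0 x, C x, S x & G 0 <= absz x]].
have ssA : same_sign A by apply: same_sign_sub ssS => x [].
exists A; split => //.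
  have uG := nonprincipal_unbounded (G 0) uU npu.
  by apply: filterS (filterI (filterI uA0 uC) (filterI uS uG)) => x [[? ?] [? ?]].
apply: (@lacunary_of_dist_large G B) ssA _.
- by move=> n; exact: (BP n).2.
- by move=> n x [A0x _ _ _]; exact: A0B.
- by move=> x [].
- move=> x y n [_ Cx _ _] [_ Cy _ _] xy dvn.
  by have /asboolP := Cb _ _ Cx Cy xy; apply.
Qed.

(** The distance [d = |y| - |x|] satisfies [|y| < 2d] and [d <= |y|]. If [|y| < |y'|], then
    [2|y| < |y'|], so the second distance exceeds [|y|], hence [d]. *)
Lemma lacunary_dist_inj (A : set int) (x y x' y' : int) :
  same_sign A -> lacunary A -> A x -> A y -> A x' -> A y' ->
  absz x < absz y -> absz x' < absz y' -> dist x y = dist x' y' ->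
  x = x' /\ y = y'.
Proof.
move=> ssA lacA Ax Ay Ax' Ay' xy xy' dE.
have d1 := ssA _ _ Ax Ay; have d2 := ssA _ _ Ax' Ay'.
have l1 := lacA _ _ Ax Ay xy; have l2 := lacA _ _ Ax' Ay' xy'.
have l3 := lacA _ _ Ay Ay'; have l4 := lacA _ _ Ay' Ay.
have [||yy] := ltngtP (absz y) (absz y'); [lia|lia|].
by split; apply: same_sign_inj ssA _ _ _ => //; lia.
Qed.

Lemma lacunary_Ramsey (u : set_system int) (A : set int)
    (R : int -> int -> Prop) :
  UltraFilter u -> Z_Ramsey u -> u A -> same_sign A -> lacunary A ->
  (forall x y, R x y -> R y x) ->
  exists B, u B /\ ((forall x y, B x -> B y -> x != y -> R x y) \/
                    (forall x y, B x -> B y -> x != y -> ~ R x y)).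
Proof.
move=> uU uR uA ssA lacA Rsym.
(* By [lacunary_dist_inj], at most one such pair of [A] realises [d], so [chi] encodes [R] on
   [A]. *)
pose chi d := `[< exists x y : int,
  [/\ A x, A y, absz x < absz y, R x y & d = dist x y] >].
have [C [b [uC Cb]]] := Z_Ramsey_distance chi uR.
exists (A `&` C); split; first exact: filterI.
suff ordered : (forall x y, (A `&` C) x -> (A `&` C) y -> absz x < absz y ->
    if b then R x y else ~ R x y).
  have sym : forall x y, (A `&` C) x -> (A `&` C) y -> x != y ->
      if b then R x y else ~ R x y.
    move=> x y ACx ACy xy; have [xlty|yltx|xyE] := ltngtP (absz x) (absz y).
    - exact: ordered.
    - have := ordered _ _ ACy ACx yltx.
      by case: (b) => [/Rsym//|nR /Rsym].
    - by case/eqP: xy; exact: same_sign_inj ssA ACx.1 ACy.1 xyE.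
  by case: (b) sym => sym; [left|right].
move=> x y [Ax Cx] [Ay Cy] xy.
have xNy : x != y by apply/eqP => ?; subst y; lia.
have := Cb _ _ Cx Cy xNy; case: (b) => [/asboolP|nchi Rxy].
  move=> [x' [y' [Ax' Ay' xy' Rxy' dE]]].
  by have [-> ->] := lacunary_dist_inj ssA lacA Ax Ay Ax' Ay' xy xy' dE.
by move/negbT/asboolP: nchi; apply; exists x, y.
Qed.

Theorem theorem5p6 (u : set_system int) (u_ultra : UltraFilter u)
    (u_nonprincipal : nonprincipal u) (u_Ramsey : Z_Ramsey u)
    (u_P_point : P_point u) :
  selective u.
Proof.
split=> // P [covP trivP _].
have [A [uA ssA lacA]] := Z_Ramsey_P_point_lacunary u_Ramsey u_P_point.
(* A set in [u] homogeneous for [R] lies in one piece or meets each piece at most once. *)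
pose R x y := exists B : set int, [/\ P B, B x & B y].
have Rsym x y : R x y -> R y x by move=> [B []]; exists B.
have [C [uC [CR|CnR]]] := lacunary_Ramsey u_ultra u_Ramsey uA ssA lacA Rsym.
  left; have [x Cx] := filter_ex uC.
  have [B PB Bx] : cover P id x by rewrite covP.
  exists B; split => //; apply: filterS uC => y Cy.
  have [<-//|xy] := eqVneq x y.
  have [B' [PB' B'x B'y]] := CR _ _ Cx Cy xy.
  by rewrite (trivP B B') //; exists x.
right; exists C; split => // B PB x y [Cx Bx] [Cy By].
have [//|xy] := eqVneq x y.
by case: (CnR _ _ Cx Cy xy); exists B.
Qed.
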